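(* Let $(V,\Omega)$ be a finite-dimensional real symplectic vector space, $A\in\mathrm{Sp}(V,\Omega)$, and let $\lambda=\pm1$ be an eigenvalue of $A$. There exists a symplectic basis of $V_{[\lambda]}$ in which the matrix associated to the restriction of $A$ to $V_{[\lambda]}$ is a symplectic direct sum of matrices of the form $$\begin{pmatrix}J(\lambda,r_j)&C(r_j,d_j,\lambda)\\ 0&\bigl(J(\lambda,r_j)^{-1}\bigr)^\tau\end{pmatrix}$$ where $C(r_j,d_j,\lambda)=\mathrm{diag}(0,\ldots,0,d_j)\bigl(J(\lambda,r_j)^{-1}\bigr)^\tau$ with $d_j\in\{0,1,-1\}$. If $d_j=0$ then $r_j$ is odd. The dimension of the eigenspace of $A$ of eigenvalue $\lambda$ is given by $2\,\mathrm{Card}\{j : d_j=0\}+\mathrm{Card}\{j : d_j\neq0\}$.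
   Context: $\mathrm{Sp}(V,\Omega)$ is the group of linear maps preserving $\Omega$; $M^\tau$ is the transpose. For $\lambda=\pm1$, $V_{[\lambda]}\subset V$ is the real generalized eigenspace of $A$ of eigenvalue $\lambda$, which is an $A$-stable symplectic subspace. A symplectic basis of a symplectic space of dimension $2m$ is a basis in which the symplectic form has matrix $\begin{pmatrix}0&\mathrm{Id}_m\\ -\mathrm{Id}_m&0\end{pmatrix}$. The symplectic direct sum of $\begin{pmatrix}A_1'&A_2'\\ A_3'&A_4'\end{pmatrix}$ and $\begin{pmatrix}A_1''&A_2''\\ A_3''&A_4''\end{pmatrix}$ (square blocks) is $$\begin{pmatrix}A_1'&0&A_2'&0\\ 0&A_1''&0&A_2''\\ A_3'&0&A_4'&0\\ 0&A_3''&0&A_4''\end{pmatrix}.$$ $J(\lambda,m)$ is the $m\times m$ Jordan matrix with $\lambda$ on the diagonal, $1$ on the superdiagonal, and $0$ elsewhere. $\mathrm{diag}(0,\ldots,0,d_j)$ is an $r_j\times r_j$ diagonal matrix. *)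

(* Defs.v *)
From HB Require Import structures.
From mathcomp Require Import all_boot all_order all_algebra.
From mathcomp Require Import reals.

Set Implicit Arguments.
Unset Strict Implicit.
Unset Printing Implicit Defensive.

Import Order.TTheory GRing.Theory Num.Theory.
Local Open Scope ring_scope.

Section GeneralizedEigenspace.
Variables (K : fieldType) (V : vectType K).
Implicit Types (f : 'End(V)) (a : K).

Definition lpow f (k : nat) : 'End(V) := iter k (comp_lfun f) \1%VF.

(* [memv_lgeigenspace] below shows that this is the set of all v such that
   (f - a)^k v = 0 for some k. *)
Definition lgeigenspace f a : {vspace V} :=
  lker (lpow (f - a *: \1%VF) (\dim {:V})).

Lemma lpowSE f k v : lpow f k.+1 v = f (lpow f k v).
Proof. by rewrite /lpow iterS comp_lfunE. Qed.

Lemma lpowDE f j k v : lpow f (j + k) v = lpow f j (lpow f k v).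
Proof. by elim: j => [|j IH]; rewrite ?addSn ?lpowSE ?IH // lfunE. Qed.

Lemma lker_lpowS f k : (lker (lpow f k) <= lker (lpow f k.+1))%VS.
Proof.
by apply/subvP => v; rewrite !memv_ker lpowSE => /eqP ->; rewrite linear0.
Qed.

Lemma lker_lpow_stab f i j :
  lker (lpow f i) = lker (lpow f i.+1) -> lker (lpow f (j + i)) = lker (lpow f i).
Proof.
move=> Ei; elim: j => // j IH; apply/vspaceP => v.
by rewrite addSnnS memv_ker lpowDE -lpowDE addnC lpowDE -memv_ker -Ei memv_ker
  -lpowDE addnC -memv_ker IH.
Qed.

Lemma lker_lpow_dim f i :
  (i <= \dim (lker (lpow f i)))%N \/ lker (lpow f i) = lker (lpow f i.+1).
Proof.
elim: i => [|i [IH|Ei]]; first by left.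
  have [/eqP Ei|ne] := boolP (lker (lpow f i) == lker (lpow f i.+1)).
    by right; rewrite -[in RHS]add2n (lker_lpow_stab 2 Ei) Ei.
  left; apply: leq_ltn_trans IH _; rewrite ltn_neqAle dimvS ?lker_lpowS // andbT.
  by apply: contra ne => /eqP ed; rewrite eqEdim lker_lpowS ed /=.
by right; rewrite -[in RHS]add2n (lker_lpow_stab 2 Ei) Ei.
Qed.

Lemma memv_lgeigenspace f a v :
  v \in lgeigenspace f a <-> exists k, iter k (fun u => f u - a *: u) v = 0.
Proof.
set g := f - a *: \1%VF; set n := \dim {:V}.
have itE k : iter k (fun u => f u - a *: u) v = lpow g k v.
  elim: k => [|k IH]; first by rewrite lfunE.
  by rewrite iterS IH lpowSE add_lfunE opp_lfunE scale_lfunE id_lfunE.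
rewrite /lgeigenspace -/g -/n; split.
  by rewrite memv_ker => /eqP vE; exists n; rewrite itE.
case=> k; rewrite itE => kv0.
have Dn j : lker (lpow g (j + n)) = lker (lpow g n).
  case: (lker_lpow_dim g n) => [dn|]; last exact: lker_lpow_stab.
  have Kn : lker (lpow g n) = fullv.
    by apply/eqP; rewrite eqEdim subvf dn.
  apply/eqP; rewrite Kn eqEsubv subvf -Kn /=.
  by elim: j => // j IH; apply: subv_trans IH _; rewrite addSn lker_lpowS.
by rewrite -(Dn k) memv_ker addnC lpowDE kv0 linear0.
Qed.

End GeneralizedEigenspace.

Section SymplecticBases.
Variables (R : realType) (V : vectType R).

Definition symplectic_basis (Omega : {skew_symmetric V}) (U : {vspace V})
    (m : nat) (e : (m + m).-tuple V) : Prop :=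
  basis_of U e /\
  \matrix_(i, j) Omega (tnth e i) (tnth e j)
    = block_mx 0 1%:M (- 1%:M) 0 :> 'M[R]_(m + m).

(* Column convention: column j holds the coordinates of f e_j. If e is a basis
   of U, such an M exists exactly when f maps U into U, and it is then the
   matrix of the restriction of f to U. *)
Definition matrix_in_basis (n : nat) (e : n.-tuple V) (f : 'End(V))
    (M : 'M[R]_n) : Prop :=
  forall j, f (tnth e j) = \sum_i M i j *: tnth e i.

End SymplecticBases.

Section SymplecticDirectSum.
Variable R : realType.

Definition sympl_dsum (m n : nat) (B' : 'M[R]_(m + m)) (B'' : 'M[R]_(n + n)) :
    'M[R]_((m + n) + (m + n)) :=
  block_mx
    (block_mx (ulsubmx B') 0 0 (ulsubmx B'')) (block_mx (ursubmx B') 0 0 (ursubmx B''))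
    (block_mx (dlsubmx B') 0 0 (dlsubmx B'')) (block_mx (drsubmx B') 0 0 (drsubmx B'')).

Fixpoint half_dim (s : seq {m : nat & 'M[R]_(m + m)}) : nat :=
  if s is B :: s' then (tag B + half_dim s')%N else 0%N.

Fixpoint big_sympl_dsum (s : seq {m : nat & 'M[R]_(m + m)}) :
    'M[R]_(half_dim s + half_dim s) :=
  if s is B :: s' then sympl_dsum (tagged B) (big_sympl_dsum s') else 0.

End SymplecticDirectSum.

Section NormalForm.
Variable R : realType.

Definition jordan_mx (a : R) (m : nat) : 'M[R]_m :=
  \matrix_(i, j) (a *+ (i == j) + (j == i.+1 :> nat)%:R).

Definition corner_mx (r : nat) (d : R) : 'M[R]_r :=
  diag_mx (\row_i (if i.+1 == r then d else 0)).

Definition C_mx (r : nat) (d a : R) : 'M[R]_r :=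
  corner_mx r d *m (invmx (jordan_mx a r))^T.

Definition normal_block (a : R) (r : nat) (d : R) : 'M[R]_(r + r) :=
  block_mx (jordan_mx a r) (C_mx r d a) 0 (invmx (jordan_mx a r))^T.

(* The j-th entry of [l] is the pair (r_j, d_j). *)
Definition normal_blocks (a : R) (l : seq (nat * R)) :
    seq {m : nat & 'M[R]_(m + m)} :=
  [seq Tagged (fun m => 'M[R]_(m + m)) (normal_block a b.1 b.2) | b <- l].

End NormalForm.

(* Main.v *)
Require Import Defs.
From HB Require Import structures.
From mathcomp Require Import all_boot all_order all_algebra.
From mathcomp Require Import reals.
From mathcomp Require Import zify ring lra.

Set Implicit Arguments.
Unset Strict Implicit.
Unset Printing Implicit Defensive.

Import Order.TTheory GRing.Theory Num.Theory.
Local Open Scope ring_scope.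

(** Put T = A - lam and S = A^-1 - lam. Since A preserves Omega, S is the
    adjoint of T; the two commute, and lam^2 = 1 gives T + S = - lam T S.
    Blocks are looked for in terms of T and S only, and everything is read off
    the moments Omega (T^a S^b e, f): they form a doubly indexed family g of
    scalars with g (a+1, b) + g (a, b+1) = - lam g (a+1, b+1), which vanishes
    once a + b reaches the nilpotency index k of T, and exchanging e and f
    exchanges a and b up to sign.

    The space is decomposed by induction on its dimension. As long as the
    space U is not zero, a symplectic A-stable subspace carrying one block is
    split off, and the induction goes on with its orthogonal complement in U.
    The block is found at the top nilpotency level k.

    If k = 2r is even, (u, v) |-> Omega (T^r S^(r-1) u, v) is a nonzero
    symmetric form on U, so some f has a nonzero square for it. Adding to f
    multiples of the vectors T^i S^i f kills the moments (j+1, j) of f for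
    j < r - 1; by the recurrence, this makes f, S f, ..., S^(r-1) f pairwise
    orthogonal. After scaling, the remaining moment is a sign, and this sign
    is lam d. The vectors S^i f and the multiples of T^(r-i) S^(r-1) f are the
    two halves of the basis ([even_chain]).

    If k = 2s + 1 is odd, the analogous form is alternating, and one takes a
    pair e, f on which it does not vanish. Each of e and f is made to have an
    isotropic cyclic space by adding multiples of T^(i+1) S^i of the other, and
    then f is corrected by multiples of S^i f so that the vectors T^(k-1-i) e
    and S^i f are dual to each other ([odd_chain]). This is a block with d = 0,
    of odd size k.

    In both cases the kernel of T on the block is found by pairing a kernel
    vector with the basis ([chain_ker]): it is a line if d <> 0 and a plane if
    d = 0, which gives the count of blocks. Finally the generalized eigenspace
    itself is symplectic, because it is orthogonal to the image of T^n, which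
    is a complement of it ([lgeigenspace_nondeg]). *)

(** * Killing scalars one at a time *)

(** The common skeleton of all corrections below: a vector is modified so as to
    annul its value at j without disturbing the larger indices already treated,
    so the indices are dealt with in decreasing order. *)
Lemma descending_choice (R : Type) (r0 : R) (T : Type) (P : T -> Prop)
    (val : T -> nat -> R) (n : nat) :
  (exists x, P x) ->
  (forall x j, P x -> (j < n)%N ->
     exists x', [/\ P x', val x' j = r0
       & forall i, (j < i < n)%N -> val x' i = val x i]) ->
  exists x, P x /\ forall j, (j < n)%N -> val x j = r0.
Proof.
move=> [x0 Px0] step.
suff H m : (m <= n)%N ->
    exists x, P x /\ forall j, (n - m <= j < n)%N -> val x j = r0.
  have [x [Px xP]] := H n (leqnn n); exists x; split=> // j jn.
  by apply: xP; rewrite subnn.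
elim: m => [_|m IH mn].
  by exists x0; split=> // j; rewrite subn0; lia.
have [x [Px xP]] := IH (ltnW mn).
have jn : (n - m.+1 < n)%N by lia.
have [x' [Px' x'0 x'P]] := step x _ Px jn.
exists x'; split=> // j /andP [jl jr].
have [->//|jne] := eqVneq j (n - m.+1)%N.
by rewrite x'P ?xP //; lia.
Qed.

(** * Moments of vectors under an adjoint pair *)

Section Moments.

Variables (R : rcfType) (V : vectType R) (Omega : {skew_symmetric V}).

(* The generic bilinearity lemmas rewrite the head of a skew-symmetric form into
   that of a plain bilinear form; these instances keep it unchanged. *)

Lemma skewC u v : Omega u v = - Omega v u.
Proof. by rewrite hermC expr1 mulN1r. Qed.

Lemma skewZl (c : R) u v : Omega (c *: u) v = c * Omega u v.
Proof. exact: linearZl_LR. Qed.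

Lemma skewZr (c : R) u v : Omega u (c *: v) = c * Omega u v.
Proof. exact: linearZr_LR. Qed.

Lemma skewDl u v w : Omega (u + v) w = Omega u w + Omega v w.
Proof. exact: linearDl. Qed.

Lemma skewDr u v w : Omega u (v + w) = Omega u v + Omega u w.
Proof. exact: linearDr. Qed.

Lemma skewBl u v w : Omega (u - v) w = Omega u w - Omega v w.
Proof. exact: linearBl. Qed.

Lemma skewBr u v w : Omega u (v - w) = Omega u v - Omega u w.
Proof. exact: linearBr. Qed.

Lemma skew_suml I (r : seq I) (P : pred I) (E : I -> V) w :
  Omega (\sum_(i <- r | P i) E i) w = \sum_(i <- r | P i) Omega (E i) w.
Proof. exact: linear_sumlz. Qed.

Variables (T S : 'End(V)) (lam : R).
Hypothesis adjTS : forall u v, Omega (T u) v = Omega u (S v).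
Hypothesis commTS : forall u, T (S u) = S (T u).
Hypothesis sumTS : forall u, T u + S u = - lam *: T (S u).

Definition monom a b v := lpow T a (lpow S b v).

Lemma monom00 v : monom 0 0 v = v.
Proof. by rewrite /monom !id_lfunE. Qed.

Lemma monomSl a b v : T (monom a b v) = monom a.+1 b v.
Proof. by rewrite /monom lpowSE. Qed.

Lemma monomSr a b v : S (monom a b v) = monom a b.+1 v.
Proof.
rewrite /monom; elim: a => [|a IH]; first by rewrite lpowSE !id_lfunE.
by rewrite lpowSE -commTS IH [RHS]lpowSE.
Qed.

Lemma monomM a b c d v : monom a b (monom c d v) = monom (a + c) (b + d) v.
Proof.
elim: a => [|a IH]; last by rewrite addSn -!monomSl IH.
elim: b => [|b IH]; first by rewrite monom00.
by rewrite addSn -!monomSr IH.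
Qed.

Lemma monomD a b u v : monom a b (u + v) = monom a b u + monom a b v.
Proof. by rewrite /monom !linearD. Qed.

Lemma monomZ a b c v : monom a b (c *: v) = c *: monom a b v.
Proof. by rewrite /monom !linearZ. Qed.

Lemma monom_rel a b v :
  monom a.+1 b v + monom a b.+1 v = - lam *: monom a.+1 b.+1 v.
Proof. by rewrite -monomSl -(monomSr a b) sumTS monomSr monomSl. Qed.

Lemma monom_adj a b u v : Omega (monom a b u) v = Omega u (monom b a v).
Proof.
elim: a v => [|a IH] v.
  elim: b v => [|b IH] v; first by rewrite !monom00.
  by rewrite -monomSr skewC -adjTS -skewC IH -[v in T v]monom00 monomSl monomM
     addn1 addn0.
by rewrite -monomSl adjTS IH -[v in S v]monom00 monomSr monomM addn1 addn0.
Qed.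

(** Bounding the powers of T is enough: the relation trades a factor S for a
    factor T without lowering the total degree, until the power of T is at
    least k. *)
Lemma monom_nilp k v : lpow T k v = 0 ->
  forall a b, (k <= a + b)%N -> monom a b v = 0.
Proof.
move=> Tk a b; have [n] := ubnP (k - a)%N.
elim: n a b => // n IH a b an kab.
have [ka|ak] := leqP k a.
  have Tk0 : monom k 0 v = 0 by rewrite /monom id_lfunE.
  by rewrite -(subnK ka) -[b]addn0 -monomM Tk0 /monom !linear0.
case: b kab => [|b] kab; first by rewrite addn0 leqNgt ak in kab.
have /eqP := monom_rel a b v.
rewrite [X in X + _]IH ?[X in - lam *: X]IH; try lia.
by rewrite scaler0 add0r => /eqP.
Qed.

Definition moment e f a b := Omega (monom a b e) f.

Lemma momentC e f a b : moment e f a b = - moment f e b a.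
Proof. by rewrite /moment monom_adj skewC. Qed.

Lemma moment_rel e f a b :
  moment e f a.+1 b + moment e f a b.+1 = - lam * moment e f a.+1 b.+1.
Proof. by rewrite /moment -skewDl monom_rel skewZl. Qed.

Lemma moment_monoml c d e f a b :
  moment (monom c d e) f a b = moment e f (a + c) (b + d).
Proof. by rewrite /moment monomM. Qed.

Lemma moment_monomr c d e f a b :
  moment e (monom c d f) a b = moment e f (a + d) (b + c).
Proof. by rewrite /moment -monom_adj monomM addnC (addnC c). Qed.

Lemma moment_pair a b c d e f :
  Omega (monom a b e) (monom c d f) = moment e f (a + d) (b + c).
Proof. exact: moment_monomr. Qed.

Lemma momentDl e e' f a b : moment (e + e') f a b = moment e f a b + moment e' f a b.
Proof. by rewrite /moment monomD skewDl. Qed.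

Lemma momentDr e f f' a b : moment e (f + f') a b = moment e f a b + moment e f' a b.
Proof. by rewrite /moment skewDr. Qed.

Lemma momentZl c e f a b : moment (c *: e) f a b = c * moment e f a b.
Proof. by rewrite /moment monomZ skewZl. Qed.

Lemma momentZr c e f a b : moment e (c *: f) a b = c * moment e f a b.
Proof. by rewrite /moment skewZr. Qed.

Definition moment_monom := (moment_monoml, moment_monomr).

Definition momentE := (momentDl, momentDr, momentZl, momentZr,
  moment_monoml, moment_monomr).

Lemma moment_perturb c z x a b :
  moment (x + c *: z) (x + c *: z) a b =
  moment x x a b + c * (moment z x a b + moment x z a b) + c ^+ 2 * moment z z a b.
Proof. by rewrite !momentE; ring. Qed.

(** The moments of a single vector are antisymmetric in (a, b), so the diagonal
    ones vanish, and T^2 = - lam (T S) T - T S expresses those at distance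
    c + 2 from the diagonal through those at distances c + 1 and c. Hence the
    moments next to the diagonal control all the others. *)
Lemma self_moment_vanish n f :
  (forall j, (j < n)%N -> moment f f j.+1 j = 0) ->
  forall a b, (a <= n)%N -> (b <= n)%N -> moment f f a b = 0.
Proof.
move=> f0.
have diag b : moment f f b b = 0.
  by have := momentC f f b b; lra.
have H c b : (b + c <= n)%N -> moment f f (b + c) b = 0.
  have [m] := ubnP c; elim: m c b => // m IH [|[|c]] b cm bn.
  - by rewrite addn0 diag.
  - by rewrite addn1 f0 //; lia.
  have := moment_rel f f (b + c.+1) b; rewrite -!addnS.
  have -> : moment f f (b + c.+1) b.+1 = 0.
    by rewrite addnS -addSn IH //; lia.
  have -> : moment f f (b + c.+2) b.+1 = 0.
    by rewrite addnS -addSn IH //; lia.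
  by rewrite mulr0 addr0.
move=> a b an bn; have [ba|ab] := leqP b a.
  by rewrite -(subnKC ba) H // subnKC.
rewrite momentC; have := H (b - a)%N a; rewrite subnKC ?(ltnW ab) // => -> //.
by rewrite oppr0.
Qed.

Section Nilpotent.

Variables (U : {vspace V}) (k : nat).
Hypothesis stabT : forall v, v \in U -> T v \in U.
Hypothesis stabS : forall v, v \in U -> S v \in U.
Hypothesis nilT : forall v, v \in U -> lpow T k v = 0.

Lemma monom_stab a b v : v \in U -> monom a b v \in U.
Proof.
move=> vU; elim: a => [|a IH]; last by rewrite -monomSl stabT.
by elim: b => [|b IH]; rewrite ?monom00 // -monomSr stabS.
Qed.

Lemma moment0 e f a b : e \in U -> (k <= a + b)%N -> moment e f a b = 0.
Proof. by move=> eU kab; rewrite /moment (monom_nilp (nilT eU)) // linear0l. Qed.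

Lemma moment_top e f a b : e \in U -> (k <= a + b + 2)%N ->
  moment e f a b.+1 = - moment e f a.+1 b.
Proof.
move=> eU kab; have := moment_rel e f a b.
by rewrite [X in - lam * X]moment0 ?mulr0 //; [lra|lia].
Qed.

(** At total degree k - 1, T and - S act alike, so all moments of that degree
    agree up to sign. *)
Lemma moment_top_neq0 e f a b a' b' : e \in U -> (a + b = a' + b')%N ->
  (k <= (a + b).+1)%N -> moment e f a b != 0 -> moment e f a' b' != 0.
Proof.
move=> eU ab kab.
have H c : (c <= a + b)%N ->
    (moment e f c (a + b - c) == 0) = (moment e f 0 (a + b) == 0).
  elim: c => [|c IH] cab; first by rewrite subn0.
  rewrite -IH ?(ltnW cab) //.
  have -> : (a + b - c = (a + b - c.+1).+1)%N by lia.
  by rewrite moment_top ?oppr_eq0 //; lia.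
have := H a; rewrite addKn leq_addr => -> //.
by have := H a'; rewrite {2 3}ab addKn ab leq_addr => -> //.
Qed.

Hypothesis nondeg : forall u, u \in U -> {in U, forall v, Omega u v = 0} -> u = 0.

Lemma top_pair : (0 < k)%N -> ~~ (U <= lker (lpow T k.-1))%VS ->
  exists e f, [/\ e \in U, f \in U & forall a b, (a + b).+1 = k -> moment e f a b != 0].
Proof.
move=> k0 /subvPn [e eU eN].
have eU' : monom k.-1 0 e \in U by apply: monom_stab.
have : monom k.-1 0 e \notin orthov Omega U.
  apply: contra eN => /mem_orthovP /(nondeg eU') e0.
  by rewrite memv_ker -e0 /monom id_lfunE.
move=> /mem_orthovPn [f fU ef]; exists e, f; split=> // a b abk.
by apply: moment_top_neq0 ef => //; lia.
Qed.

(** On the top degree 2r + 1 the moments of index (r+1, r) form a nonzero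
    symmetric form, which is not alternating; this provides the first vector.
    Perturbing f by a multiple of T^i S^i f leaves the moments (j+1, j) with
    j > r - i unchanged and shifts the one with j = r - i by a multiple of the
    top moment, hence can annul it. *)
Lemma even_vector r : k = r.+1.*2 -> ~~ (U <= lker (lpow T k.-1))%VS ->
  exists f, [/\ f \in U, moment f f r.+1 r != 0
    & forall j, (j < r)%N -> moment f f j.+1 j = 0].
Proof.
move=> kr top; have k0 : (0 < k)%N by rewrite kr.
have [e [f [eU fU ef]]] := top_pair k0 top.
have [g [gU gN]] : exists g, g \in U /\ moment g g r.+1 r != 0.
  have ef0 : moment e f r.+1 r != 0 by apply: ef; lia.
  have [ee|/= ee] := eqVneq (moment e e r.+1 r) 0; last by exists e.
  have [ff|/= ff] := eqVneq (moment f f r.+1 r) 0; last by exists f.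
  exists (e + f); split; first exact: rpredD.
  rewrite !momentE ee ff (momentC f e) moment_top //; last lia.
  by rewrite opprK addr0 add0r -mulr2n mulrn_eq0 negb_or.
pose P f := f \in U /\ moment f f r.+1 r != 0.
have [|{fU ef} f j|x [[xU xN] xP]] := @descending_choice R 0 V P
    (fun f j => moment f f j.+1 j) r; last by exists x.
  by exists g.
move=> [fU fN] jr.
(* The factor 2 appears because the two cross terms of the perturbation are
   equal. *)
pose c := - moment f f j.+1 j / (moment f f r.+1 r *+ 2).
have cE : c * (moment f f r.+1 r *+ 2) = - moment f f j.+1 j.
  by rewrite /c divfK // mulrn_eq0 negb_or.
pose i := (r - j)%N.
have iE : (j + i = r)%N by rewrite /i; lia.
have big a b : (k <= a + b)%N -> moment f f a b = 0 by apply: moment0.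
exists (f + c *: monom i i f); split.
- split; first by rewrite rpredD // rpredZ // monom_stab.
  rewrite moment_perturb !moment_monom ![moment _ _ (_ + _) _]big; try lia.
  by rewrite addr0 !mulr0 !addr0.
- rewrite moment_perturb !moment_monom [X in _ ^+ 2 * X]big; last lia.
  by rewrite mulr0 addr0 addSn iE -mulr2n cE subrr.
move=> l jl.
rewrite moment_perturb !moment_monom ![moment _ _ (_ + _) _]big; try lia.
by rewrite addr0 !mulr0 !addr0.
Qed.

(** For odd k the moments of e alone vanish at the top degree, by antisymmetry,
    so e is corrected by means of f: at j = s - 1 - i, the cross terms with
    T^(i+1) S^i f are top moments of the pair (e, f), while the own moment of
    T^(i+1) S^i f vanishes for degree reasons. *)
Lemma isotropic_correction s e f : k = s.*2.+1 -> e \in U -> f \in U ->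
  moment e f s s != 0 ->
  exists e', [/\ e' \in U, moment e' f s s = moment e f s s
    & forall a b, moment e' e' a b = 0].
Proof.
move=> ks eU fU efN.
pose P x := x \in U /\ moment x f s s = moment e f s s.
have [|x j|x [[xU xN] xP]] := @descending_choice R 0 V P
    (fun x j => moment x x j.+1 j) s; first by exists e.
  move=> [xU xf] js.
  pose c := - moment x x j.+1 j / (moment e f s s *+ 2).
  have cE : c * (moment e f s s *+ 2) = - moment x x j.+1 j.
    by rewrite /c divfK // mulrn_eq0 negb_or.
  pose i := (s - j.+1)%N.
  have iE : (j.+1 + i = s)%N by rewrite /i; lia.
  have bigx g a b : (k <= a + b)%N -> moment x g a b = 0 by apply: moment0.
  have bigf g a b : (k <= a + b)%N -> moment f g a b = 0 by apply: moment0.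
  exists (x + c *: monom i.+1 i f); split.
  - split; first by rewrite rpredD // rpredZ // monom_stab.
    by rewrite !momentE bigf ?mulr0 ?addr0 //; lia.
  - rewrite moment_perturb !moment_monom [X in _ ^+ 2 * X]bigf; last lia.
    (* One of the cross terms is brought to the index (s, s) by moving one
       factor across the diagonal, which costs a sign that cancels the one of
       the exchange of f and x. *)
    rewrite (momentC f x).
    have -> : (j.+1 + i.+1 = s.+1)%N by lia.
    have -> : (j + i.+1 = s)%N by lia.
    have -> : (j + i = s.-1)%N by lia.
    rewrite iE -[in X in moment x f _ X](prednK (n := s)); last by lia.
    rewrite moment_top //; last lia.
    rewrite prednK; last lia.
    by rewrite opprK xf mulr0 addr0 -mulr2n cE subrr.
  move=> l jl; rewrite moment_perturb !moment_monom.
  rewrite ![moment f _ (_ + _) _]bigf ?[moment x _ (_ + _) _]bigx; try lia.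
  by rewrite addr0 !mulr0 !addr0.
exists x; split=> // a b.
apply: (@self_moment_vanish (maxn a b)); rewrite ?leq_maxl ?leq_maxr // => l _.
have [ls|sl] := ltnP l s; first exact: xP.
by apply: moment0 => //; lia.
Qed.

(** Isotropy of f survives the last correction because all moments of S^i f,
    and those between f and S^i f, are moments of f. *)
Lemma odd_pair s : k = s.*2.+1 -> ~~ (U <= lker (lpow T k.-1))%VS ->
  exists e f, [/\ e \in U, f \in U,
    forall a b, moment e e a b = 0 /\ moment f f a b = 0, moment e f s.*2 0 = 1
    & forall j, (j < s.*2)%N -> moment e f j 0 = 0].
Proof.
move=> ks top; have k0 : (0 < k)%N by rewrite ks.
have [e0 [f0 [e0U f0U ef0]]] := top_pair k0 top.
have {}ef0 : moment e0 f0 s s != 0 by apply: ef0; lia.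
have [e [eU ef ee]] := isotropic_correction ks e0U f0U ef0.
have fe : moment f0 e s s != 0 by rewrite momentC ef oppr_eq0.
have [f1 [f1U fe1 ff]] := isotropic_correction ks f0U eU fe.
have ef1 : moment e f1 s.*2 0 != 0.
  apply: (@moment_top_neq0 e f1 s s) => //; try lia.
  by rewrite momentC fe1 oppr_eq0.
pose P x := [/\ x \in U, forall a b, moment x x a b = 0 & moment e x s.*2 0 = 1].
have [|{fe1 ff ef1 f1U} x j|x [[xU xx x1] xP]] :=
    @descending_choice R 0 V P (fun x j => moment e x j 0) s.*2.
- exists ((moment e f1 s.*2 0)^-1 *: f1); split; first exact: rpredZ.
    by move=> a b; rewrite !momentE ff !mulr0.
  by rewrite momentE mulVf.
- move=> [xU xx x1] js.
  have bige a b : (k <= a + b)%N -> moment e x a b = 0 by apply: moment0.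
  exists (x + (- moment e x j 0) *: monom 0 (s.*2 - j) x); split.
  + split; first by rewrite rpredD // rpredZ // monom_stab.
      by move=> a b; rewrite moment_perturb !moment_monom !xx !addr0 !mulr0 !addr0.
    by rewrite !momentE [X in _ * X]bige ?mulr0 ?addr0 //; lia.
  + by rewrite !momentE subnKC ?(ltnW js) // !addn0 x1 mulr1 subrr.
  by move=> i ij; rewrite !momentE [X in _ * X]bige ?mulr0 ?addr0 //; lia.
by exists e, x; split=> // a b; rewrite ee xx.
Qed.

(** Scaling by t multiplies moments by t^2, so the sign of the top moment is an
    invariant: this is where the sign d of the block comes from, and where
    square roots are needed. *)
Lemma even_vector_sign r : k = r.+1.*2 -> ~~ (U <= lker (lpow T k.-1))%VS ->
  exists f, [/\ f \in U, moment f f r.+1 r \in [:: 1; -1]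
    & forall j, (j < r)%N -> moment f f j.+1 j = 0].
Proof.
move=> kr top; have [f [fU fN f0]] := even_vector kr top.
set x := moment f f r.+1 r in fN.
pose t := Num.sqrt `|x|^-1.
have t2 : t * (t * x) = Num.sg x.
  rewrite mulrA -expr2 sqr_sqrtr ?invr_ge0 ?normr_ge0 //.
  by rewrite {2}[x]numEsg mulrCA mulVf ?mulr1 ?normr_eq0.
exists (t *: f); split; first exact: rpredZ.
  by rewrite !momentE t2 !inE -sqrf_eq1 sqr_sg fN.
by move=> j jr; rewrite !momentE f0 // !mulr0.
Qed.

(** Two chains realizing one block, without reference to matrices. In terms of
    A, the relation on Q says A^-1 Q_i = lam Q_i + Q_(i+1), which describes the
    inverse transpose of the Jordan block; the last relation closes the chain Q
    through P and is the corner entry d. *)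
Definition normal_chain (r : nat) (d : R) (P Q : nat -> V) : Prop :=
  [/\ forall i, (i < r)%N -> P i \in U /\ Q i \in U,
      forall i j, (i < r)%N -> (j < r)%N ->
        [/\ Omega (P i) (P j) = 0, Omega (Q i) (Q j) = 0
          & Omega (P i) (Q j) = (i == j)%:R],
      T (P 0) = 0 /\ forall i, (i.+1 < r)%N -> T (P i.+1) = P i,
      forall i, (i.+1 < r)%N -> S (Q i) = Q i.+1
    & lam *: T (Q r.-1) = d *: P r.-1].

Lemma odd_chain s : k = s.*2.+1 -> ~~ (U <= lker (lpow T k.-1))%VS ->
  exists P Q, normal_chain k 0 P Q.
Proof.
move=> ks top; have [e [f [eU fU iso ef1 ef0]]] := odd_pair ks top.
have ef a : moment e f a 0 = (a == s.*2)%:R.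
  have [a1|a1|->] := ltngtP a s.*2; [by rewrite ef0| |by rewrite ef1].
  by rewrite moment0 //; lia.
have kill a b x : (k <= a + b)%N -> x \in U -> monom a b x = 0.
  by move=> ab xU; apply: monom_nilp (nilT xU) _ _ ab.
exists (fun i => monom (s.*2 - i) 0 e), (fun i => monom 0 i f).
split=> [i _|i j ik jk||i _|]; first by split; apply: monom_stab.
- rewrite !moment_pair ef; split; try by case: (iso _ _).
  + by case: (iso (s.*2 - i + 0)%N (0 + (s.*2 - j))%N).
  + by case: (iso (0 + j)%N (i + 0)%N).
  by congr (_%:R); lia.
- split=> [|i ik]; first by rewrite monomSl kill //; lia.
  by rewrite monomSl; congr monom; lia.
- by rewrite monomSr.
by rewrite monomSl kill ?scaler0 ?scale0r //; lia.
Qed.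

Hypothesis lam2 : lam * lam = 1.

Lemma even_chain r : k = r.+1.*2 -> ~~ (U <= lker (lpow T k.-1))%VS ->
  exists d P Q, d \in [:: 1; -1] /\ normal_chain r.+1 d P Q.
Proof.
move=> kr top; have [f [fU]] := even_vector_sign kr top.
set eps := moment _ _ _ _ => epsP f0.
have eps2 : eps * eps = 1.
  by move: epsP; rewrite !inE => /orP [] /eqP ->; rewrite ?mulrNN mulr1.
have low a b : (a <= r)%N -> (b <= r)%N -> moment f f a b = 0.
  exact: self_moment_vanish.
have kill a b : (k <= a + b)%N -> monom a b f = 0.
  exact: monom_nilp (nilT fU) _ _.
have high a b : (k <= a + b)%N -> moment f f a b = 0.
  exact: moment0.
exists (lam * eps), (fun i => eps *: monom (r.+1 - i) r f), (fun i => monom 0 i f).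
split.
  have : (lam * eps) ^+ 2 == 1 by rewrite expr2 mulrACA lam2 eps2 mulr1.
  by rewrite sqrf_eq1 !inE.
split=> [i _|i j ik jk||i _|].
- by split; rewrite ?rpredZ ?monom_stab.
- rewrite !skewZl !skewZr !moment_pair; split.
  + by rewrite high ?mulr0 //; lia.
  + by rewrite low //; lia.
  have [ij|ij|ij] := ltngtP i j.
  + by rewrite high ?mulr0 //; lia.
  + by rewrite low ?mulr0 //; lia.
  have -> : (r.+1 - i + j = r.+1)%N by lia.
  by rewrite addn0.
- split=> [|i ik]; first by rewrite linearZ /= monomSl kill ?scaler0 //; lia.
  by rewrite linearZ /= monomSl; congr (_ *: monom _ _ _); lia.
- by rewrite monomSr.
rewrite monomSl /= subSnn scalerA; congr (_ *: _).
by rewrite -mulrA eps2 mulr1.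
Qed.

End Nilpotent.
End Moments.

(** * Darboux bases *)

Section Darboux.

Variables (R : realType) (V : vectType R) (Omega : {skew_symmetric V}).

Definition darboux m (p q : m.-tuple V) : Prop :=
  forall i j, [/\ Omega (tnth p i) (tnth p j) = 0,
                  Omega (tnth q i) (tnth q j) = 0
                & Omega (tnth p i) (tnth q j) = (i == j)%:R].

Section One.

Variables (m : nat) (p q : m.-tuple V).
Hypothesis pq : darboux p q.

Let e := [tuple of p ++ q].

Lemma darboux_gram :
  \matrix_(i, j) Omega (tnth e i) (tnth e j)
    = block_mx 0 1%:M (- 1%:M) 0 :> 'M[R]_(m + m).
Proof.
apply/matrixP => i j; rewrite mxE.
have [a ->|a ->] := split_ordP i; have [b ->|b ->] := split_ordP j;
  have [pp qq pq1] := pq a b; have [_ _ pq2] := pq b a;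
  rewrite ?(tnth_lshift, tnth_rshift)
    ?(block_mxEul, block_mxEur, block_mxEdl, block_mxEdr) !mxE //.
by rewrite skewC pq2 eq_sym.
Qed.

(** The Gram matrix G of a Darboux family satisfies G^2 = -1, so a combination
    orthogonal to the whole family has zero coefficients. *)
Lemma darboux_coef0 (k : 'I_(m + m) -> R) :
  (forall j, Omega (\sum_i k i *: tnth e i) (tnth e j) = 0) -> forall i, k i = 0.
Proof.
move=> k0 j; pose G : 'M[R]_(m + m) := block_mx 0 1%:M (- 1%:M) 0.
have GG : G *m G = - 1%:M.
  rewrite /G mulmx_block !(mul0mx, mulmx0, mul1mx, mulmx1, add0r, addr0).
  by rewrite scalar_mx_block opp_block_mx oppr0.
have kG : (\row_i k i) *m G = 0.
  rewrite /G -darboux_gram; apply/rowP => i; rewrite !mxE -{}[RHS](k0 i).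
  by rewrite skew_suml; apply: eq_bigr => l _; rewrite !mxE skewZl.
have /rowP/(_ j) : (\row_i k i) *m (G *m G) = 0 by rewrite mulmxA kG mul0mx.
by rewrite GG mulmxN mulmx1 !mxE => /eqP; rewrite oppr_eq0 => /eqP.
Qed.

Lemma darboux_basis : symplectic_basis Omega <<e>> e.
Proof.
split; last exact: darboux_gram.
rewrite basisEfree subvv dim_span !andbT; apply/freeP => k k0.
apply: darboux_coef0 => j.
under eq_bigr do rewrite (tnth_nth 0).
by rewrite k0 linear0l.
Qed.

Lemma mem_darboux_ortho w :
  (forall i, Omega w (tnth p i) = 0) -> (forall i, Omega w (tnth q i) = 0) ->
  w \in orthov Omega <<e>>.
Proof.
move=> wp wq; rewrite mem_orthov_sym; apply/span_subvP => x.
rewrite mem_cat mem_orthov1 skewC oppr_eq0 => /orP [] /tnthP [i ->].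
  by rewrite wp.
by rewrite wq.
Qed.

Definition darboux_proj v :=
  \sum_i Omega v (tnth q i) *: tnth p i - \sum_i Omega v (tnth p i) *: tnth q i.

Lemma darboux_proj_mem v : darboux_proj v \in <<e>>%VS.
Proof.
by rewrite rpredB // rpred_sum // => i _; rewrite rpredZ // memv_span // mem_cat
  mem_tnth ?orbT.
Qed.

Lemma darboux_proj_ortho v : v - darboux_proj v \in orthov Omega <<e>>.
Proof.
have delta (F : 'I_m -> R) i : \sum_j F j * (j == i)%:R = F i.
  rewrite (bigD1 i) //= eqxx mulr1 big1 ?addr0 // => j /negPf ->.
  by rewrite mulr0.
apply: mem_darboux_ortho => i; rewrite /darboux_proj !skewBl !skew_suml.
  rewrite [X in _ - (X - _)]big1 => [|j _].
    rewrite (eq_bigr (fun j => - (Omega v (tnth p j) * (j == i)%:R))).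
      by rewrite sumrN delta sub0r !opprK subrr.
    move=> j _; rewrite skewZl skewC; have [_ _ ->] := pq i j.
    by rewrite mulrN eq_sym.
  by rewrite skewZl; have [-> _ _] := pq j i; rewrite mulr0.
rewrite [X in _ - (_ - X)]big1 => [|j _].
  rewrite (eq_bigr (fun j => Omega v (tnth q j) * (j == i)%:R)).
    by rewrite delta subr0 subrr.
  by move=> j _; rewrite skewZl; have [_ _ ->] := pq j i.
by rewrite skewZl; have [_ -> _] := pq j i; rewrite mulr0.
Qed.

Lemma darboux_nondeg v :
  v \in <<e>>%VS -> v \in orthov Omega <<e>> -> v = 0.
Proof.
move=> ve /mem_orthovP v0; rewrite (coord_span ve) big1 // => i _.
rewrite (@darboux_coef0 (fun i => coord e i v)) ?scale0r // => j.
under eq_bigr do rewrite (tnth_nth 0).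
by rewrite -coord_span // v0 // memv_span // mem_tnth.
Qed.

End One.

(** In a symplectic direct sum the two families are interleaved: first halves
    together, then second halves. *)
Lemma span_interleave m n (p1 q1 : m.-tuple V) (p2 q2 : n.-tuple V) :
  <<(p1 ++ p2) ++ (q1 ++ q2)>>%VS = (<<p1 ++ q1>> + <<p2 ++ q2>>)%VS.
Proof. by rewrite !span_cat Monoid.mulmACA. Qed.

Lemma darboux_cat m n (p1 q1 : m.-tuple V) (p2 q2 : n.-tuple V) :
  darboux p1 q1 -> darboux p2 q2 ->
  {in <<p1 ++ q1>>%VS & <<p2 ++ q2>>%VS, forall u v, Omega u v = 0} ->
  darboux [tuple of p1 ++ p2] [tuple of q1 ++ q2].
Proof.
move=> d1 d2 ort.
have ort' u v : u \in p1 ++ q1 -> v \in p2 ++ q2 -> Omega u v = 0 /\ Omega v u = 0.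
  move=> uin vin; have uv : Omega u v = 0 by apply: ort; apply: memv_span.
  by rewrite [Omega v u]skewC uv oppr0.
have m1 i : tnth p1 i \in p1 ++ q1 by rewrite mem_cat mem_tnth.
have n1 i : tnth q1 i \in p1 ++ q1 by rewrite mem_cat mem_tnth orbT.
have m2 i : tnth p2 i \in p2 ++ q2 by rewrite mem_cat mem_tnth.
have n2 i : tnth q2 i \in p2 ++ q2 by rewrite mem_cat mem_tnth orbT.
move=> i j; have [a ->|a ->] := split_ordP i; have [b ->|b ->] := split_ordP j;
  rewrite ?(tnth_lshift, tnth_rshift).
- by have [-> -> ->] := d1 a b; rewrite (inj_eq (@lshift_inj _ _)).
- by rewrite !(ort' _ _ _ _).1 ?eq_lrshift.
- by rewrite !(ort' _ _ _ _).2 ?eq_rlshift.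
by have [-> -> ->] := d2 a b; rewrite (inj_eq (@rshift_inj _ _)).
Qed.

Lemma sum_tuple_cat m n (x : m.-tuple V) (y : n.-tuple V) (F : 'I_(m + n) -> R) :
  \sum_i F i *: tnth [tuple of x ++ y] i
    = \sum_i F (lshift n i) *: tnth x i + \sum_i F (rshift m i) *: tnth y i.
Proof.
by rewrite big_split_ord; congr (_ + _); apply: eq_bigr => i _;
  rewrite ?(tnth_lshift, tnth_rshift).
Qed.

Lemma matrix_in_basis_dsum (A : 'End(V)) m n (p1 q1 : m.-tuple V)
    (p2 q2 : n.-tuple V) M1 M2 :
  matrix_in_basis [tuple of p1 ++ q1] A M1 ->
  matrix_in_basis [tuple of p2 ++ q2] A M2 ->
  matrix_in_basis [tuple of [tuple of p1 ++ p2] ++ [tuple of q1 ++ q2]] A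
    (sympl_dsum M1 M2).
Proof.
move=> A1 A2 j.
have zero k (x : k.-tuple V) (F : 'I_k -> R) :
    (forall i, F i = 0) -> \sum_i F i *: tnth x i = 0.
  by move=> F0; rewrite big1 // => i _; rewrite F0 scale0r.
have same k (x : k.-tuple V) (F G : 'I_k -> R) :
    F =1 G -> \sum_i G i *: tnth x i = \sum_i F i *: tnth x i.
  by move=> FG; apply: eq_bigr => i _; rewrite FG.
have entry := (block_mxEul, block_mxEur, block_mxEdl, block_mxEdr).
rewrite !sum_tuple_cat.
have [j' ->|j' ->] := split_ordP j; have [b ->|b ->] := split_ordP j';
  rewrite ?(tnth_lshift, tnth_rshift).
- have := A1 (lshift m b); rewrite tnth_lshift sum_tuple_cat => ->.
  congr (_ + _); [rewrite [X in _ + X]zero|rewrite [X in _ + X]zero];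
    rewrite ?addr0; try (by move=> i; rewrite /sympl_dsum !entry mxE);
    by apply: same => i; rewrite /sympl_dsum !entry !mxE.
- have := A2 (lshift n b); rewrite tnth_lshift sum_tuple_cat => ->.
  congr (_ + _); [rewrite [X in X + _]zero|rewrite [X in X + _]zero];
    rewrite ?add0r; try (by move=> i; rewrite /sympl_dsum !entry mxE);
    by apply: same => i; rewrite /sympl_dsum !entry !mxE.
- have := A1 (rshift m b); rewrite tnth_rshift sum_tuple_cat => ->.
  congr (_ + _); [rewrite [X in _ + X]zero|rewrite [X in _ + X]zero];
    rewrite ?addr0; try (by move=> i; rewrite /sympl_dsum !entry mxE);
    by apply: same => i; rewrite /sympl_dsum !entry !mxE.
have := A2 (rshift n b); rewrite tnth_rshift sum_tuple_cat => ->.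
congr (_ + _); [rewrite [X in X + _]zero|rewrite [X in X + _]zero];
  rewrite ?add0r; try (by move=> i; rewrite /sympl_dsum !entry mxE);
  by apply: same => i; rewrite /sympl_dsum !entry !mxE.
Qed.

End Darboux.

(** * The matrix of one block *)

Section NormalBlock.

Variables (R : realType) (V : vectType R).

Lemma sum_delta_nat r (n : nat) (F : nat -> V) :
  \sum_(i < r) (n == i :> nat)%:R *: F i = if (n < r)%N then F n else 0.
Proof.
case: ltnP => nr; last first.
  by rewrite big1 // => i _; rewrite gtn_eqF ?scale0r // (leq_trans _ nr).
rewrite (bigD1 (Ordinal nr)) //= eqxx scale1r big1 ?addr0 // => i.
by rewrite -val_eqE /= eq_sym => /negPf ->; rewrite scale0r.
Qed.

Lemma jordan_mx_unit (a : R) r : a != 0 -> jordan_mx a r \in unitmx.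
Proof.
move=> a0; rewrite unitmxE -det_tr det_trig; last first.
  apply/is_trig_mxP => i j ij; rewrite !mxE -val_eqE gtn_eqF // mulr0n add0r.
  by rewrite ltn_eqF // (ltn_trans ij).
rewrite unitfE prodf_seq_neq0; apply/allP => i _; apply/implyP => _.
by rewrite !mxE eqxx mulr1n ltn_eqF // addr0.
Qed.

(** The images of the Q_i are only given implicitly, by
    sum_l J_il A Q_l = Q_i + D_i P_i with D the corner matrix; inverting J on
    this triangular system produces both the inverse transpose of J and the
    block C = D J^-T. *)
Lemma normal_block_basis (A : 'End(V)) (lam d : R) r (P Q : nat -> V) :
  lam != 0 ->
  A (P 0) = lam *: P 0 ->
  (forall i, (i.+1 < r)%N -> A (P i.+1) = lam *: P i.+1 + P i) ->
  (forall i, (i.+1 < r)%N -> lam *: A (Q i) + A (Q i.+1) = Q i) ->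
  lam *: A (Q r.-1) = Q r.-1 + d *: P r.-1 ->
  matrix_in_basis [tuple of [tuple P i | i < r] ++ [tuple Q i | i < r]] A
    (normal_block lam r d).
Proof.
move=> lam0 AP0 AP AQ AQr j; rewrite sum_tuple_cat.
under eq_bigr do rewrite tnth_mktuple.
under [X in _ + X]eq_bigr do rewrite tnth_mktuple.
have [b ->|b ->] := split_ordP j; rewrite ?(tnth_lshift, tnth_rshift) tnth_mktuple.
  under eq_bigr do rewrite block_mxEul mxE scalerDl -[lam *+ _]mulr_natr -scalerA.
  rewrite big_split /= -scaler_sumr.
  rewrite [X in _ + X]big1 => [|i _]; last by rewrite block_mxEdl mxE scale0r.
  rewrite addr0 [X in _ *: X](_ : _ = P b); last first.
    have := sum_delta_nat r b P; rewrite ltn_ord => <-.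
    by apply: eq_bigr => i _; rewrite eq_sym.
  case: b => [[|b] br] /=.
    by rewrite big1 ?addr0 // => i _; rewrite scale0r.
  under eq_bigr do rewrite eqSS.
  by rewrite sum_delta_nat (ltnW br) AP.
have J i : \sum_l (jordan_mx lam r) i l *: A (Q l)
    = Q i + (if i.+1 == r then d else 0) *: P i.
  under eq_bigr do rewrite mxE scalerDl -[lam *+ _]mulr_natr -scalerA.
  rewrite big_split /= -scaler_sumr.
  rewrite (sum_delta_nat r i (A \o Q)) ltn_ord.
  under eq_bigr do rewrite eq_sym.
  rewrite (sum_delta_nat r i.+1 (A \o Q)) /=.
  have [ir|ir|ir] := ltngtP i.+1 r; first by rewrite AQ // scale0r addr0.
    by have := ltn_ord i; rewrite leqNgt ir.
  by rewrite addr0 (_ : (i : nat) = r.-1) ?AQr //; lia.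
under eq_bigr do rewrite block_mxEur /C_mx /corner_mx mul_diag_mx !mxE.
under [X in _ + X]eq_bigr do rewrite block_mxEdr mxE.
transitivity (\sum_i invmx (jordan_mx lam r) b i *:
   (\sum_l (jordan_mx lam r) i l *: A (Q l))); last first.
  rewrite -big_split /=; apply: eq_bigr => i _.
  by rewrite J scalerDr scalerA addrC mulrC.
under eq_bigr do rewrite scaler_sumr.
rewrite exchange_big /=.
under eq_bigr => l _ do (under eq_bigr do rewrite scalerA; rewrite -scaler_suml).
transitivity (\sum_l (1%:M : 'M[R]_r) b l *: A (Q l)); last first.
  apply: eq_bigr => l _; congr (_ *: _).
  by rewrite -(mulVmx (jordan_mx_unit r lam0)) mxE.
under eq_bigr do rewrite mxE.
by rewrite (sum_delta_nat r b (A \o Q)) ltn_ord.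
Qed.

End NormalBlock.

(** * Stable subspaces *)

Section Subspaces.

Variables (K : fieldType) (V : vectType K).

Lemma linv_stable (A : 'End(V)) (X : {vspace V}) :
  lker A = 0%VS -> (A @: X <= X)%VS -> forall v, v \in X -> (A^-1)%VF v \in X.
Proof.
move=> kA AX v vX.
have AXe : (A @: X)%VS = X.
  by apply/eqP; rewrite eqEdim AX limg_dim_eq ?leqnn ?kA ?capv0.
move: vX; rewrite -{1}AXe => /memv_imgP [w wX ->].
by rewrite lker0_lfunK ?kA.
Qed.

Lemma dim_ker_sum (T : 'End(V)) (X Y : {vspace V}) :
  (T @: X <= X)%VS -> (T @: Y <= Y)%VS -> (X :&: Y)%VS = 0%VS ->
  \dim (lker T :&: (X + Y)) = (\dim (lker T :&: X) + \dim (lker T :&: Y))%N.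
Proof.
move=> TX TY XY; rewrite -dimv_disjoint_sum; last first.
  apply/eqP; rewrite -subv0 -XY; apply/subvP => v.
  by rewrite !memv_cap => /andP [/andP [_ ->] /andP [_ ->]].
congr (\dim _); apply/eqP; rewrite eqEsubv; apply/andP; split; apply/subvP => v.
  rewrite memv_cap => /andP [Tv /memv_addP [x xX [y yY vE]]]; move: Tv.
  rewrite vE memv_ker linearD /= addr_eq0 => /eqP Txy.
  have : T x \in (X :&: Y)%VS.
    by rewrite memv_cap (subvP TX) ?memv_img // Txy rpredN (subvP TY) ?memv_img.
  rewrite XY memv0 => /eqP Tx.
  move: Txy => /eqP; rewrite Tx eq_sym oppr_eq0 => /eqP Ty.
  by rewrite memv_add // memv_cap memv_ker ?Tx ?Ty eqxx.
move=> /memv_addP [x xK [y yK ->]]; move: xK yK; rewrite !memv_cap !memv_ker.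
move=> /andP [/eqP Tx xX] /andP [/eqP Ty yY].
by rewrite memv_add // linearD /= Tx Ty addr0 eqxx.
Qed.

End Subspaces.

(** * Decomposition of the generalized eigenspace *)

Section Spectral.

Variables (R : realType) (V : vectType R) (Omega : {skew_symmetric V}).
Hypothesis Omega_sympl : is_psymplectic Omega.
Variable A : 'End(V).
Hypothesis A_Sp : isometry Omega Omega A.
Variable lam : R.
Hypothesis lam2 : lam * lam = 1.

Let B := (A^-1)%VF.
Let T : 'End(V) := A - lam *: \1%VF.
Let S : 'End(V) := B - lam *: \1%VF.

Let TE v : T v = A v - lam *: v.
Proof. by rewrite add_lfunE opp_lfunE scale_lfunE id_lfunE. Qed.

Let SE v : S v = B v - lam *: v.
Proof. by rewrite add_lfunE opp_lfunE scale_lfunE id_lfunE. Qed.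

Lemma lam_neq0 : lam != 0.
Proof. by apply/eqP => l0; move: lam2; rewrite l0 mul0r => /eqP; rewrite eq_sym oner_eq0. Qed.

Lemma Omega_nondeg u : (forall v, Omega u v = 0) -> u = 0.
Proof.
move=> u0; case: Omega_sympl => /eqP radE _ _.
by apply/eqP; rewrite -memv0 -radE; apply/mem_orthovP => v _.
Qed.

Lemma isometry_ker0 : lker A = 0%VS.
Proof.
apply/eqP; rewrite -subv0; apply/subvP => u; rewrite memv_ker memv0 => /eqP Au.
by apply/eqP/Omega_nondeg => v; rewrite -A_Sp Au linear0l.
Qed.

Let AK v : B (A v) = v.
Proof. by rewrite /B lker0_lfunK ?isometry_ker0. Qed.

Let BK v : A (B v) = v.
Proof. by rewrite /B lker0_lfunVK ?isometry_ker0. Qed.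

Lemma shift_adj u v : Omega (T u) v = Omega u (S v).
Proof.
have AB : Omega (A u) v = Omega u (B v) by rewrite -{1}[v]BK A_Sp.
by rewrite TE SE skewBl skewBr skewZl skewZr AB.
Qed.

Let TSE u : T (S u) = u + u - lam *: (A u + B u).
Proof.
rewrite SE TE linearB linearZ /= BK scalerBr scalerA lam2 scale1r.
by rewrite opprB addrACA -opprD scalerDr.
Qed.

Lemma shift_comm u : T (S u) = S (T u).
Proof.
rewrite !TE !SE !linearB !linearZ /= AK BK.
by rewrite addrACA.
Qed.

Lemma shift_sum u : T u + S u = - lam *: T (S u).
Proof.
rewrite TSE TE SE scaleNr scalerBr scalerA lam2 scale1r opprB.
by rewrite addrACA -opprD scalerDr.
Qed.

Lemma shift_ker v : T v = 0 -> S v = 0.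
Proof.
rewrite TE => /eqP; rewrite subr_eq0 => /eqP Av.
have : v = lam *: B v by rewrite -{1}[v]AK Av linearZ.
by move=> /(congr1 (fun x => lam *: x)); rewrite scalerA lam2 scale1r SE => ->; rewrite subrr.
Qed.

Section Chain.

Variables (U : {vspace V}) (r : nat) (d : R) (P Q : nat -> V).
Hypothesis r0 : (0 < r)%N.
Hypothesis chain : normal_chain Omega T S lam U r d P Q.

Let p := [tuple P i | i < r].
Let q := [tuple Q i | i < r].
Let X := <<p ++ q>>%VS.

Lemma chain_darboux : darboux Omega p q.
Proof.
case: chain => _ PQ _ _ _ i j; rewrite !tnth_mktuple.
by have [] := PQ i j (ltn_ord i) (ltn_ord j).
Qed.

Lemma chain_mem i : (i < r)%N -> P i \in X /\ Q i \in X.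
Proof.
move=> ir.
have -> : P i = tnth p (Ordinal ir) by rewrite tnth_mktuple.
have -> : Q i = tnth q (Ordinal ir) by rewrite tnth_mktuple.
by split; rewrite memv_span // mem_cat mem_tnth ?orbT.
Qed.

Lemma chain_sub : (X <= U)%VS.
Proof.
case: chain => PU _ _ _ _; apply/span_subvP => x.
by rewrite mem_cat => /orP [] /tnthP [i ->]; rewrite tnth_mktuple; case: (PU i).
Qed.

Lemma chain_matrix : matrix_in_basis [tuple of p ++ q] A (normal_block lam r d).
Proof.
case: chain => _ _ [P0 PS] QS Qr.
have AE v : A v = T v + lam *: v by rewrite TE subrK.
have AQ v : lam *: A v + A (S v) = v.
  by rewrite SE linearB linearZ /= BK addrC subrK.
apply: normal_block_basis; first exact: lam_neq0.
- by rewrite AE P0 add0r.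
- by move=> i ir; rewrite AE PS // addrC.
- by move=> i ir; rewrite -QS.
by rewrite AE scalerDr Qr scalerA lam2 scale1r addrC.
Qed.

(** A vector v of the kernel of T is also killed by S, hence is orthogonal to
    the images of T and S. These contain every P_i but the last, every Q_i but
    the first, and also the last P when d <> 0. In the Darboux basis only the
    coordinates of v along P_0 and, if d = 0, the last Q can survive. *)
Lemma chain_ker : \dim (lker T :&: X) = (1 + (d == 0%R))%N.
Proof.
case: chain => _ PQ [P0 PS] QS Qr.
have [P0X _] := chain_mem r0.
have r1 : (r.-1 < r)%N by rewrite prednK.
have [_ QrX] := chain_mem r1.
have dQ : d = 0 -> T (Q r.-1) = 0.
  move=> d0; move: Qr; rewrite d0 scale0r => /eqP.
  by rewrite scaler_eq0 (negPf lam_neq0) => /eqP.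
have -> : (lker T :&: X = <[P 0]> + (if d == 0%R then <[Q r.-1]> else 0))%VS.
  apply/eqP; rewrite eqEsubv; apply/andP; split; last first.
    rewrite subv_add -memvE memv_cap memv_ker P0 eqxx P0X /=.
    case: eqP => [d0|_]; last exact: sub0v.
    by rewrite -memvE memv_cap memv_ker dQ // eqxx QrX.
  apply/subvP => v; rewrite memv_cap memv_ker => /andP [/eqP Tv vX].
  have Sv := shift_ker Tv.
  have vQ i : (i.+1 < r)%N -> Omega v (Q i.+1) = 0.
    by move=> ir; rewrite -QS // -shift_adj Tv linear0l.
  have vP i : (i.+1 < r)%N -> Omega v (P i) = 0.
    by move=> ir; rewrite -PS // skewC shift_adj Sv linear0r oppr0.
  have vPr : d != 0 -> Omega v (P r.-1) = 0.
    move=> d0; apply: (mulfI d0); rewrite mulr0 -skewZr -Qr skewZr.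
    by rewrite skewC shift_adj Sv linear0r oppr0 mulr0.
  have vE : v = darboux_proj Omega p q v.
    apply/eqP; rewrite -subr_eq0; apply/eqP.
    apply: (darboux_nondeg chain_darboux).
      by rewrite rpredB // darboux_proj_mem.
    exact: (darboux_proj_ortho chain_darboux).
  rewrite vE /darboux_proj; apply: rpredB; rewrite rpred_sum // => i _;
    rewrite !tnth_mktuple.
    case: i => [[|i] ir] /=; last by rewrite vQ // scale0r mem0v.
    by rewrite (subvP (addvSl _ _)) // rpredZ // memv_line.
  have [ir|ri] := ltnP i.+1 r; first by rewrite vP // scale0r mem0v.
  have -> : (i : nat) = r.-1 by have := ltn_ord i; lia.
  case: eqP => [_|/eqP d0]; last by rewrite vPr // scale0r mem0v.
  by rewrite (subvP (addvSr _ _)) // rpredZ // memv_line.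
have [_ _ PQ0] := PQ 0 0 r0 r0.
have [_ QQ _] := PQ r.-1 0 r1 r0.
have [_ _ PQr] := PQ _ _ r1 r1.
rewrite dimv_disjoint_sum.
  rewrite dim_vline; congr (_ + _)%N.
    by case: eqP => // P00; move/eqP: PQ0; rewrite P00 linear0l eqxx eq_sym oner_eq0.
  case: (d == 0); rewrite ?dimv0 // dim_vline.
  by case: eqP => // Q0; move/eqP: PQr; rewrite Q0 linear0r eqxx eq_sym oner_eq0.
apply/eqP; rewrite -subv0; case: ifP => _; last by rewrite capv0.
apply/subvP => v; rewrite memv_cap memv0 => /andP [/vlineP [a ->] /vlineP [b ab]].
have := congr1 (fun x => Omega x (Q 0)) ab.
by rewrite !skewZl PQ0 QQ mulr0 eqxx mulr1 => ->; rewrite scale0r.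
Qed.

End Chain.

(** The conclusion for an arbitrary A-stable symplectic subspace, as needed for
    the induction; the two halves of the basis are kept apart since a direct sum
    concatenates them separately. *)
Definition has_normal_form (U : {vspace V}) : Prop :=
  exists (l : seq (nat * R)) (p q : (half_dim (normal_blocks lam l)).-tuple V),
    [/\ darboux Omega p q, U = <<p ++ q>>%VS,
        matrix_in_basis [tuple of p ++ q] A (big_sympl_dsum (normal_blocks lam l)),
        (forall (r : nat) (d : R), (r, d) \in l ->
           [/\ (0 < r)%N, d \in [:: 0; 1; -1] & d = 0 -> odd r])
      & \dim (lker T :&: U)
          = (2 * count (fun b : nat * R => b.2 == 0%R) l
             + count (fun b : nat * R => b.2 != 0%R) l)%N].

Lemma exists_chain (U : {vspace V}) : U != 0%VS ->
  (A @: U <= U)%VS ->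
  (forall u, u \in U -> {in U, forall v, Omega u v = 0} -> u = 0) ->
  (U <= lgeigenspace A lam)%VS ->
  exists r d P Q,
    [/\ (0 < r)%N, d \in [:: 0; 1; -1], d = 0 -> odd r
      & normal_chain Omega T S lam U r d P Q].
Proof.
move=> U0 AU nd Ugen.
have [k nilk mink] : exists2 k, (U <= lker (lpow T k))%VS
    & forall j, (U <= lker (lpow T j))%VS -> (k <= j)%N.
  by case: (ex_minnP (P := fun k => (U <= lker (lpow T k))%VS)) => [|k]; exists k || exists (\dim {:V}).
have k0 : (0 < k)%N.
  case: k nilk {mink} => // U1; case/negP: U0; rewrite -subv0.
  by apply/subvP => v /(subvP U1); rewrite memv_ker id_lfunE memv0.
have top : ~~ (U <= lker (lpow T k.-1))%VS.
  by apply/negP => /mink; rewrite leqNgt prednK // leqnn.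
have stabT v : v \in U -> T v \in U.
  by move=> vU; rewrite TE rpredB ?rpredZ // (subvP AU) // memv_img.
have stabS v : v \in U -> S v \in U.
  by move=> vU; rewrite SE rpredB ?rpredZ // linv_stable // isometry_ker0.
have nilT v : v \in U -> lpow T k v = 0.
  by move=> /(subvP nilk); rewrite memv_ker => /eqP.
have kE := odd_double_half k.
case: (odd k) kE => [/esym kE|/esym kE].
  have [P [Q chain]] := odd_chain shift_adj shift_comm shift_sum stabT stabS nilT nd kE top.
  by exists k, 0, P, Q; split; rewrite ?inE ?eqxx // kE /= odd_double.
move: kE; case: (k./2) => [|r] kE; first by rewrite kE in k0.
have [d [P [Q [dP chain]]]] :=
  even_chain shift_adj shift_comm shift_sum stabT stabS nilT nd lam2 kE top.
exists r.+1, d, P, Q; split=> //; first by rewrite inE dP orbT.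
by move: dP; rewrite !inE => /orP [] /eqP -> /eqP; rewrite ?oppr_eq0 oner_eq0.
Qed.

(** The orthogonal complement of a block in U is again A-stable, because the
    block is stable under A^-1, and symplectic, because it is a complement of
    the block in U. *)
Lemma normal_form (U : {vspace V}) :
  (A @: U <= U)%VS ->
  (forall u, u \in U -> {in U, forall v, Omega u v = 0} -> u = 0) ->
  (U <= lgeigenspace A lam)%VS ->
  has_normal_form U.
Proof.
have [n] := ubnP (\dim U); elim: n U => // n IH U dimU AU nd Ugen.
have [->|U0] := eqVneq U 0%VS.
  exists [::], [tuple], [tuple]; split=> //; first by case.
  - by rewrite span_nil.
  - by case.
  by rewrite capv0 dimv0.
have [r [d [P [Q [r0 dP dodd chain]]]]] := exists_chain U0 AU nd Ugen.
pose p := [tuple P i | i < r]; pose q := [tuple Q i | i < r].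
pose X := <<p ++ q>>%VS.
have dpq : darboux Omega p q := chain_darboux chain.
have XU : (X <= U)%VS := chain_sub chain.
have Apq := chain_matrix chain.
have AX : (A @: X <= X)%VS.
  rewrite limg_span; apply/span_subvP => _ /mapP [x xin ->].
  move: xin => /(@tnthP _ _ [tuple of p ++ q]) [i ->].
  by rewrite Apq rpred_sum // => j _; rewrite rpredZ // memv_span // mem_tnth.
pose W := (U :&: orthov Omega X)%VS.
have UE : U = (X + W)%VS.
  apply/eqP; rewrite eqEsubv subv_add XU capvSl !andbT; apply/subvP => v vU.
  have prX := darboux_proj_mem Omega p q v.
  rewrite -(subrK (darboux_proj Omega p q v) v) addrC memv_add //.
  rewrite memv_cap (darboux_proj_ortho dpq) andbT rpredB //.
  exact: (subvP XU).
have XW : (X :&: W)%VS = 0%VS.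
  apply/eqP; rewrite -subv0; apply/subvP => v; rewrite !memv_cap memv0.
  by move=> /and3P [vX _ vo]; apply/eqP; apply: (darboux_nondeg dpq).
have ortW x w : x \in X -> w \in W -> Omega w x = 0.
  by move=> xX; rewrite memv_cap => /andP [_ /mem_orthovP]; apply.
have AW : (A @: W <= W)%VS.
  apply/subvP => _ /memv_imgP [w wW ->].
  have wU : w \in U by move: wW; rewrite memv_cap => /andP [].
  rewrite memv_cap (subvP AU) ?memv_img //; apply/mem_orthovP => x xX.
  rewrite -[x]BK A_Sp ortW // linv_stable //; exact: isometry_ker0.
have WU : (W <= U)%VS by apply: capvSl.
have [l [p' [q' [dpq' WE Apq' lP dimW]]]] : has_normal_form W.
  apply: IH => //; last exact: subv_trans Ugen.
  - rewrite -ltnS; apply: leq_ltn_trans dimU.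
    have [/size_basis dimX _] := darboux_basis dpq.
    by rewrite UE dimv_disjoint_sum // dimX -[X in (X < _)%N]add0n ltn_add2r addn_gt0 r0.
  move=> u uW u0; apply: nd; first exact: (subvP WU).
  move=> v; rewrite {1}UE => /memv_addP [x xX [w wW ->]].
  by rewrite skewDr ortW // u0 // addr0.
exists ((r, d) :: l), [tuple of p ++ p'], [tuple of q ++ q']; split.
- apply: darboux_cat => // x w xX; rewrite -WE => wW.
  by rewrite skewC ortW // oppr0.
- by rewrite UE span_interleave -WE.
- exact: matrix_in_basis_dsum.
- move=> r' d'; rewrite inE => /orP [/eqP [-> ->]|/lP] //.
rewrite UE dim_ker_sum //; first last.
- apply/subvP => _ /memv_imgP [w wW ->].
  by rewrite TE rpredB ?rpredZ // (subvP AW) // memv_img.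
- apply/subvP => _ /memv_imgP [w wW ->].
  by rewrite TE rpredB ?rpredZ // (subvP AX) // memv_img.
rewrite dimW (chain_ker r0 chain) /=.
by case: eqP => _ /=; lia.
Qed.

Lemma lgeigenspace_stable : (A @: lgeigenspace A lam <= lgeigenspace A lam)%VS.
Proof.
apply/subvP => _ /memv_imgP [v vG ->]; apply/memv_lgeigenspace.
have [k vk] := (memv_lgeigenspace A lam v).1 vG; exists k.
have it j : iter j (fun u => A u - lam *: u) (A v)
    = A (iter j (fun u => A u - lam *: u) v).
  by elim: j => // j IH; rewrite !iterS IH [RHS]linearB /= [in RHS]linearZ.
by rewrite it vk linear0.
Qed.

(** With n the dimension of V, V is the direct sum of the kernel and the image
    of T^n (the kernels have stabilized), and the two are orthogonal since
    S^n also vanishes on the kernel. A vector orthogonal to the kernel and lying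
    in it is thus orthogonal to V. *)
Lemma lgeigenspace_nondeg u : u \in lgeigenspace A lam ->
  {in lgeigenspace A lam, forall v, Omega u v = 0} -> u = 0.
Proof.
set G := lgeigenspace A lam; set n := \dim {:V} => uG u0.
have Gn v : (v \in G) = (lpow T n v == 0) by rewrite memv_ker.
pose I := limg (lpow T n).
have GI : (G :&: I)%VS = 0%VS.
  apply/eqP; rewrite -subv0; apply/subvP => v; rewrite memv_cap memv0.
  move=> /andP [vG /memv_imgP [w _ vE]].
  suff : w \in G by rewrite Gn -vE.
  apply/memv_lgeigenspace; exists (n + n)%N.
  have it j x : iter j (fun u => A u - lam *: u) x = lpow T j x.
    by elim: j => [|j IH]; rewrite ?id_lfunE // iterS IH lpowSE TE.
  by rewrite it lpowDE -vE; apply/eqP; rewrite -Gn.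
have full : (G + I)%VS = fullv.
  apply/eqP; rewrite eqEdim subvf dimv_disjoint_sum //.
  rewrite -/n /n -(limg_ker_dim (lpow T n) fullv) capfv; exact: leqnn.
apply: Omega_nondeg => v.
have : v \in (G + I)%VS by rewrite full memvf.
move=> /memv_addP [x xG [_ /memv_imgP [w _ ->] ->]].
rewrite skewDr u0 // add0r.
have -> : lpow T n w = monom T S n 0 w by rewrite /monom id_lfunE.
rewrite -(monom_adj shift_adj shift_comm) (monom_nilp shift_comm shift_sum (k := n)).
- by rewrite linear0l.
- by apply/eqP; rewrite -Gn.
by [].
Qed.

Lemma leigenspace_sub : (lker T <= lgeigenspace A lam)%VS.
Proof.
apply/subvP => v; rewrite memv_ker => /eqP Tv; apply/memv_lgeigenspace.
by exists 1%N; rewrite /= -TE.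
Qed.

End Spectral.

Theorem theorem24 (R : realType) (V : vectType R) (Omega : {skew_symmetric V})
    (Omega_sympl : is_psymplectic Omega)
    (A : 'End(V)) (A_Sp : isometry Omega Omega A)
    (lam : R) (lam_pm1 : lam = 1 \/ lam = -1)
    (lam_eigen : passmx.leigenvalue A lam) :
  exists (l : seq (nat * R))
         (e : (half_dim (normal_blocks lam l)
               + half_dim (normal_blocks lam l)).-tuple V),
    [/\ symplectic_basis Omega (lgeigenspace A lam) e,
        matrix_in_basis e A (big_sympl_dsum (normal_blocks lam l)),
        (forall (r : nat) (d : R), (r, d) \in l ->
           [/\ (0 < r)%N, d \in [:: 0; 1; -1] & d = 0 -> odd r])
      & \dim (passmx.leigenspace A lam)
          = (2 * count (fun b : nat * R => b.2 == 0%R) l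
             + count (fun b : nat * R => b.2 != 0%R) l)%N].
Proof.
have lam2 : lam * lam = 1 by case: lam_pm1 => ->; rewrite ?mulrNN mulr1.
have [l [p [q [dpq GE Apq lP dimG]]]] :=
  normal_form Omega_sympl A_Sp lam2 (lgeigenspace_stable A lam)
    (lgeigenspace_nondeg Omega_sympl A_Sp lam2) (subvv _).
exists l, [tuple of p ++ q]; split=> //; first by rewrite GE; apply: darboux_basis.
by rewrite -dimG; congr (\dim _); apply/esym/capv_idPl/leigenspace_sub.
Qed.
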